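(* Let $n, r, m$ be positive integers with $r\leq n/2$. For a tuple $\mathcal{A}=\{A_1,\ldots,A_m\}$ of $m$ matrices in $\mathbb{C}^{n\times n}$, consider the map $\mathbf{M}_{\mathcal{A}}:\mathbb{C}^{n\times n}\to\mathbb{C}^m$, $\mathbf{M}_{\mathcal{A}}(Q)=[\langle A_1,Q\rangle,\ldots,\langle A_m,Q\rangle]$. The following holds. (a) If $m\geq 4nr-4r^2$, then $\mathbf{M}_{\mathcal{A}}$ is injective on $\mathcal{L}_r^{\mathbb{C}}$ for generic matrices $A_1,\ldots,A_m\in\mathbb{C}^{n\times n}$. (b) If $m<4nr-4r^2$, then (for every choice of $A_1,\ldots,A_m\in\mathbb{C}^{n\times n}$) $\mathbf{M}_{\mathcal{A}}$ is not injective on $\mathcal{L}_r^{\mathbb{C}}$.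
   Context: For $A,Q\in\mathbb{C}^{n\times n}$, $\langle A,Q\rangle:=\mathrm{trace}(A^*Q)$, where $A^*$ is the conjugate transpose. $\mathcal{L}_r^{\mathbb{C}}:=\{X\in\mathbb{C}^{n\times n}:\mathrm{rank}(X)\leq r\}$. A statement holds ''for generic matrices $A_1,\ldots,A_m$'' in $\mathbb{C}^{n\times n}$ if there is a non-empty Zariski open subset $U$ of $\mathbb{C}^{mn^2}$ (which is then also open and dense in the Euclidean topology) such that the statement holds whenever $[A_1,\ldots,A_m]$, viewed as a point of $\mathbb{C}^{mn^2}$, lies in $U$. *)

(* Defs.v *)
From mathcomp Require Import all_boot all_order all_algebra.
From mathcomp Require Import sesquilinear spectral complex mpoly.
From mathcomp Require Import boolp classical_sets reals.

Set Implicit Arguments.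
Unset Strict Implicit.
Unset Printing Implicit Defensive.

Import GRing.Theory Num.Theory.
Local Open Scope ring_scope.
Local Open Scope complex_scope.
Local Open Scope sesquilinear_scope.
Local Open Scope classical_set_scope.

(* The family S may be infinite. *)
Definition zariski_closed (K : fieldType) (d : nat) (Z : set 'rV[K]_d) : Prop :=
  exists S : set {mpoly K[d]},
    Z = [set v : 'rV[K]_d | forall p : {mpoly K[d]}, S p -> p.@[v ord0] = 0].

Definition zariski_open (K : fieldType) (d : nat) (U : set 'rV[K]_d) : Prop :=
  zariski_closed (~` U).

Definition tuple_point (K : fieldType) (m n : nat) (A : 'I_m -> 'M[K]_n) :
    'rV[K]_(m * (n * n)) :=
  mxvec (\matrix_(i < m) mxvec (A i)).

Definition for_generic_matrices (K : fieldType) (m n : nat)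
    (P : ('I_m -> 'M[K]_n) -> Prop) : Prop :=
  exists U : set 'rV[K]_(m * (n * n)),
    [/\ zariski_open U, U !=set0 & forall A, U (tuple_point A) -> P A].

(* [A ^t*] is the conjugate transpose. *)
Definition inner_mx (R : realType) (n : nat) (A Q : 'M[R[i]]_n) : R[i] :=
  \tr (A ^t* *m Q).

Definition meas_map (R : realType) (m n : nat) (A : 'I_m -> 'M[R[i]]_n)
    (Q : 'M[R[i]]_n) : 'rV[R[i]]_m :=
  \row_(k < m) inner_mx (A k) Q.

Definition rank_le (R : realType) (n r : nat) : {pred 'M[R[i]]_n} :=
  [pred X : 'M[R[i]]_n | (\rank X <= r)%N].

Arguments rank_le : clear implicits.

(* Main.v *)
(* M_A is injective on matrices of rank <= r iff its kernel meets the cone V of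
   matrices of rank <= k = 2r only in 0, and dim V = D = n^2 - (n - k)^2.

   (a) Charts parametrize the tuples annihilating some nonzero X in V by
   (D - 1) + m (n^2 - 1) < m n^2 variables, so the m n^2 entries of such a tuple
   satisfy a nontrivial polynomial relation.

   (b) Let m < D linear forms l_i have no common nonzero zero on V.  By the
   Nullstellensatz a power of every coordinate lies in I(V) + (l_i), so C[V] is a
   finite module over C[l_1, ..., l_m], and polynomials of degree s on V form a
   space of dimension O(s^m).  But D of the coordinates are algebraically
   independent on V.

   The Nullstellensatz is proved from the uncountability of C: if u - z is
   invertible modulo J for all z, then uncountably many of these inverses have
   bounded degree, and a linear relation between them makes u algebraic mod J. *)
Require Import Defs.
From mathcomp Require Import all_boot all_order all_algebra.
From mathcomp Require Import complex reals.
From mathcomp Require Import mpoly boolp classical_sets.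
From mathcomp Require Import cardinality finmap zify ring lra.
Set Implicit Arguments.
Unset Strict Implicit.
Unset Printing Implicit Defensive.

Import Order.TTheory GRing.Theory Num.Theory.
Local Open Scope ring_scope.

(** * Polynomials as functions, linear dependence and counting of monomials *)

Lemma poly_eq0_horner (K : numDomainType) (p : {poly K}) :
  (forall x, p.[x] = 0) -> p = 0.
Proof.
move=> p0; apply/eqP/contraT => pN0.
have := @max_poly_roots _ p [seq i%:R | i <- iota 0 (size p)] pN0.
rewrite size_map size_iota ltnn; apply.
  by apply/allP => x _; rewrite /root p0.
rewrite map_inj_uniq ?iota_uniq // => i j /eqP.
by rewrite eqr_nat => /eqP.
Qed.

(** Induction on the number of variables. With the first [n] variables fixed, [p] becomes a
    polynomial in the last one that vanishes at every point, so its coefficients, the values of the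
    [slice j], are zero. *)
Lemma mpoly_eq0_meval (K : numDomainType) n (p : {mpoly K[n]}) :
  (forall v, p.@[v] = 0) -> p = 0.
Proof.
elim: n p => [|n IHn] p p0.
  apply/mpolyP => m; rewrite mcoeff0; have := p0 (fun _ => 0).
  rewrite {1}(mpolyE p) raddf_sum /=.
  under eq_bigr do rewrite mevalZ mevalX big_ord0.
  have E (m' : 'X_{1..0}) : m' = m by apply/mnmP => -[].
  under eq_bigr => m' _ do rewrite mulr1.
  have := msupp_uniq p; case Ep: (msupp p) => [|m0 [|m1 s]] /=.
  - by move=> _ _; apply: memN_msupp_eq0; rewrite Ep.
  - by rewrite big_seq1 (E m0).
  - by rewrite (E m0) (E m1) mem_head.
pose res (m : 'X_{1..n.+1}) := [multinom (m (widen_ord (leqnSn n) i)) | i < n].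
pose slice j := \sum_(m <- msupp p | m ord_max == j) p@_m *: 'X_[res m].
have slice0 j : slice j = 0.
  apply: IHn => v.
  pose q := \sum_(m <- msupp p) (p@_m * 'X_[res m].@[v]) *: 'X^(m ord_max).
  have q0 : q = 0.
    apply: poly_eq0_horner => x.
    rewrite -(p0 (fun i => if unlift ord_max i is Some i' then v i' else x)).
    rewrite {1}(mpolyE p) raddf_sum horner_sum; apply: eq_bigr => m _.
    rewrite /= hornerZ hornerXn mevalZ !mevalX big_ord_recr /= unlift_none.
    rewrite -mulrA; congr (_ * (_ * _)); apply: eq_bigr => i _.
    rewrite mnmE; have -> : widen_ord (leqnSn n) i = lift ord_max i.
      by apply: val_inj; rewrite /= /bump leqNgt ltn_ord.
    by rewrite liftK.
  have := congr1 (fun r : {poly K} => r`_j) q0; rewrite coef0 coef_sum => <-.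
  rewrite /slice raddf_sum /= big_mkcond /=; apply: eq_bigr => m _.
  rewrite coefZ coefXn eq_sym; case: eqP => _; last by rewrite mulr0.
  by rewrite mevalZ mulr1.
apply/mpolyP => m; rewrite mcoeff0.
have [mp|] := boolP (m \in msupp p); last exact: memN_msupp_eq0.
have := congr1 (mcoeff (res m)) (slice0 (m ord_max)).
rewrite mcoeff0 => <-; rewrite /slice raddf_sum /= big_mkcond (bigD1_seq m) //=.
rewrite eqxx mcoeffZ mcoeffX eqxx mulr1 big1 ?addr0 // => m' m'm.
case: eqP => // mm'; rewrite mcoeffZ mcoeffX.
case: eqP => [/mnmP E|_]; last by rewrite mulr0.
case/eqP: m'm; apply/mnmP => i; case: (unliftP ord_max i) => [i' ->|->] //.
have := E i'; rewrite !mnmE; congr (m' _ = m _);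
  by apply: val_inj; rewrite /= /bump leqNgt ltn_ord.
Qed.

Lemma mpoly_meval_neq0 (K : numDomainType) n (p : {mpoly K[n]}) :
  p != 0 -> exists v, p.@[v] != 0.
Proof.
move=> /eqP pN0; apply: contrapT => Nv; apply: pN0; apply: mpoly_eq0_meval => v.
by apply/eqP/contraT => pv; case: Nv; exists v.
Qed.

Lemma lin_dep (K : fieldType) (I J : finType) (a : I -> J -> K) :
  (#|J| < #|I|)%N ->
  exists2 c : I -> K, exists i, c i != 0 & forall j, \sum_i c i * a i j = 0.
Proof.
move=> ltJI; pose M := \matrix_(i < #|I|, j < #|J|) a (enum_val i) (enum_val j).
have kerN0 : kermx M != 0.
  by rewrite kermx_eq0 -row_leq_rank -ltnNge (leq_ltn_trans (rank_leq_col _)).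
have [k kN0] : exists k, row k (kermx M) != 0.
  apply: contrapT => N; case/eqP: kerN0; apply/row_matrixP => k; rewrite row0.
  by apply/eqP/contraT => ?; case: N; exists k.
have /rV0Pn[i ciN0] := kN0.
exists (fun x => row k (kermx M) 0 (enum_rank x)).
  by exists (enum_val i); rewrite enum_valK.
move=> j; have /rowP/(_ (enum_rank j)) : row k (kermx M) *m M = 0.
  by rewrite -row_mul mulmx_ker row0.
rewrite [LHS]mxE [RHS]mxE => E; rewrite -[RHS]E (reindex (@enum_val I I)) /=.
  by apply: eq_bigr => x _; rewrite enum_valK [M _ _]mxE enum_rankK.
by apply: onW_bij; apply: enum_val_bij.
Qed.

(** For s = C (B+1)^d the left side is at most s (s+1)^d, which is less than (s+1)^(d+1). All
    comparisons of transcendence degrees below rest on this growth. *)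
Lemma expn_growth (B C d e : nat) : (d < e)%N ->
  exists s, (C * (B * s).+1 ^ d < s.+1 ^ e)%N.
Proof.
move=> lt_de; pose s := (C * B.+1 ^ d)%N; exists s.
have le1 : ((B * s).+1 ^ d <= (B.+1 * s.+1) ^ d)%N.
  by have [->|d0] := posnP d; rewrite // leq_exp2r //; nia.
apply: leq_ltn_trans (leq_mul (leqnn C) le1) _.
rewrite expnMn mulnA -/s; apply: leq_trans (_ : s.+1 ^ d.+1 <= _)%N.
  by rewrite expnS ltn_pmul2r ?expn_gt0.
by rewrite leq_pexp2l.
Qed.

Lemma leq_mnm_mdeg n (m : 'X_{1..n}) i : (m i <= mdeg m)%N.
Proof. by rewrite mdegE (bigD1 i) //= leq_addr. Qed.

Lemma card_bmultinom n b : (#|{: 'X_{1..n < b}}| <= b ^ n)%N.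
Proof.
pose f (m : 'X_{1..n < b}) : {ffun 'I_n -> 'I_b} :=
  [ffun i => Ordinal (leq_ltn_trans (leq_mnm_mdeg m i) (bmdeg m))].
suff f_inj : injective f.
  by have := leq_card f f_inj; rewrite card_ffun !card_ord.
move=> m1 m2 /ffunP E; apply/val_inj/mnmP => i.
by have := congr1 val (E i); rewrite !ffunE.
Qed.

Definition ffun_mnm s n (a : {ffun 'I_n -> 'I_s}) : 'X_{1..n} :=
  [multinom (a i : nat) | i < n].

Lemma ffun_mnm_inj s n : injective (@ffun_mnm s n).
Proof.
move=> a b /mnmP E; apply/ffunP => i; apply: val_inj.
by have := E i; rewrite !mnmE.
Qed.

Lemma ffun_mpoly_neq0 (K : fieldType) s n (c : {ffun 'I_n -> 'I_s} -> K) a :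
  c a != 0 -> \sum_b c b *: 'X_[ffun_mnm b] != 0.
Proof.
apply: contraNneq => E; have := congr1 (mcoeff (ffun_mnm a)) E.
rewrite mcoeff0 raddf_sum /= (bigD1 a) //= mcoeffZ mcoeffX eqxx mulr1.
rewrite big1 ?addr0 => [-> //|b /negPf ba].
by rewrite mcoeffZ mcoeffX (inj_eq (@ffun_mnm_inj s n)) ba mulr0.
Qed.

Lemma meval_bounded (K : fieldType) n b (p : {mpoly K[n]}) : (msize p <= b)%N ->
  forall v, p.@[v] = \sum_(m : 'X_{1..n < b}) p@_m * 'X_[m].@[v].
Proof.
move=> pb v; rewrite {1}(mpolywE pb) raddf_sum /=.
by apply: eq_bigr => m _; rewrite mevalZ.
Qed.

(** Degrees add up to at most B n s. [msize] exceeds the degree by one except at 0, whence the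
    successors and the separate treatment of zero factors. *)
Lemma msize_prod_exp (K : fieldType) n d (phi : 'I_n -> {mpoly K[d]}) B s
    (a : 'I_n -> 'I_s.+1) :
  (forall i, (msize (phi i) <= B.+1)%N) ->
  (msize (\prod_i phi i ^+ a i) <= (B * n * s).+1)%N.
Proof.
move=> phiB.
have szX p k : (msize p <= B.+1)%N -> (msize (p ^+ k : {mpoly K[d]}) <= (B * k).+1)%N.
  move=> pB; elim: k => [|k IHk]; first by rewrite expr0 msize1.
  have [->|pN0] := eqVneq p 0; first by rewrite expr0n /= msize0.
  by rewrite exprS msizeM ?expf_neq0 //; move: (msize p) (msize (p ^+ k)) IHk pB => x y; lia.
have -> : (B * n * s)%N = (\sum_(i < n) B * s)%N.
  by rewrite sum_nat_const card_ord mulnA (mulnC n).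
apply: (big_ind2 (fun (p : {mpoly K[d]}) k => (msize p <= k.+1)%N))
  => [|p k q l pk ql|i _]; first by rewrite msize1.
  have [->|pN0] := eqVneq p 0; first by rewrite mul0r msize0.
  have [->|qN0] := eqVneq q 0; first by rewrite mulr0 msize0.
  by rewrite msizeM //; move: (msize p) (msize q) pk ql => x y; lia.
by apply: leq_trans (szX _ _ (phiB i)) _; rewrite ltnS leq_mul // -ltnS.
Qed.

(** The (s+1)^e products of powers of the [phi i] with exponents at most [s] lie in the space of
    polynomials of degree at most B e s, of dimension at most (B e s + 1)^d. For a suitable [s]
    there are more products than dimensions. *)
Lemma alg_dep (K : fieldType) d e (phi : 'I_e -> {mpoly K[d]}) : (d < e)%N ->
  exists2 F : {mpoly K[e]}, F != 0 &
    forall v, F.@[fun i => (phi i).@[v]] = 0.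
Proof.
move=> lt_de; pose B := (\max_i msize (phi i))%N.
have phiB i : (msize (phi i) <= B.+1)%N by apply/leqW/leq_bigmax.
have [s ltC] := expn_growth (B * e) 1 lt_de.
pose a (x : {ffun 'I_e -> 'I_s.+1}) (m : 'X_{1..d < (B * e * s).+1}) :=
  (\prod_i phi i ^+ x i)@_m.
have [|c [x cx] c0] := @lin_dep K _ _ a.
  rewrite (leq_ltn_trans (card_bmultinom _ _)) // card_ffun !card_ord.
  by rewrite mul1n in ltC.
exists (\sum_x c x *: 'X_[ffun_mnm x]); first exact: ffun_mpoly_neq0 cx.
move=> v; rewrite raddf_sum /=.
transitivity (\sum_x c x * \sum_m a x m * 'X_[m].@[v]).
  apply: eq_bigr => y _; rewrite mevalZ mevalX.
  rewrite -(meval_bounded (msize_prod_exp _ phiB)) rmorph_prod.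
  by congr (_ * _); apply: eq_bigr => i _; rewrite mnmE rmorphXn.
under eq_bigr do rewrite mulr_sumr.
rewrite exchange_big big1 //= => m _.
by under eq_bigr do rewrite mulrA; rewrite -mulr_suml c0 mul0r.
Qed.

(** * Ideals and the Nullstellensatz over an uncountable algebraically closed field *)

Definition ideal (S : comNzRingType) (J : S -> Prop) : Prop :=
  [/\ J 0, forall p q, J p -> J q -> J (p + q) & forall a p, J p -> J (a * p)].

(** For an ideal [J] this is J + (u), and [adjoin J u 1] says that [u] is invertible modulo [J]. *)
Definition adjoin (S : comNzRingType) (J : S -> Prop) (u : S) : S -> Prop :=
  fun p => exists a, J (p - a * u).

Lemma ideal_adjoin (S : comNzRingType) (J : S -> Prop) u :
  ideal J -> ideal (adjoin J u).
Proof.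
move=> [J0 JD JM]; split=> [|p q [a Ja] [b Jb]|b p [a Ja]].
- by exists 0; rewrite mul0r subr0.
- by exists (a + b); rewrite mulrDl opprD addrACA; apply: JD.
- by exists (b * a); rewrite -mulrA -mulrBr; apply: JM.
Qed.

Lemma ideal_sum (S : comNzRingType) (J : S -> Prop) (I : finType) (F : I -> S) :
  ideal J -> (forall i, J (F i)) -> J (\sum_i F i).
Proof. by move=> [J0 JD _] JF; apply: big_ind => // i _. Qed.

Lemma idealB (S : comNzRingType) (J : S -> Prop) x y :
  ideal J -> J x -> J y -> J (x - y).
Proof. by move=> [_ JD JM] Jx Jy; rewrite -mulN1r; apply/JD/JM. Qed.

Lemma idealZ (K : fieldType) (S : comAlgType K) (J : S -> Prop) (c : K) x :
  ideal J -> J x -> J (c *: x).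
Proof. by move=> [_ _ JM] Jx; rewrite -mulr_algl; apply: JM. Qed.

(* The factors u - z with z != 0 are invertible modulo J and cancel. *)
Lemma ideal_prod_shift (K : fieldType) (S : comAlgType K) (J : S -> Prop)
    (u : S) (s : seq K) e :
  ideal J -> (forall z, z != 0 -> adjoin J (u - z%:A) 1) ->
  J ((\prod_(z <- s) (u - z%:A)) * u ^+ e) -> exists t, J (u ^+ t).
Proof.
move=> idJ inv; have [_ JD JM] := idJ.
elim: s e => [|z s IHs] e; first by rewrite big_nil mul1r; exists e.
rewrite big_cons; have [->|z0] := eqVneq z 0.
  by rewrite scale0r subr0 => Jx; apply: (IHs e.+1); rewrite exprS mulrCA mulrA.
set x := \prod_(_ <- _) _ => Jx; have [a Ja] := inv z z0.
apply: (IHs e); rewrite -/x.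
have -> : x * u ^+ e =
    (x * u ^+ e) * (1 - a * (u - z%:A)) + a * ((u - z%:A) * x * u ^+ e).
  by ring.
by apply: JD; apply: JM.
Qed.

Lemma ideal_shift_dep (K : fieldType) n (J : {mpoly K[n]} -> Prop) u
    (r : seq K) (q : K -> {mpoly K[n]}) b :
  ideal J -> uniq r -> (forall z, z \in r -> J (1 - q z * (u - z%:A))) ->
  (forall z, z \in r -> (msize (q z) <= b)%N) -> (#|{: 'X_{1..n < b}}| < size r)%N ->
  exists2 p : {poly K}, p != 0 & J (horner_alg u p).
Proof.
move=> idJ r_uniq Jq qb lt_r.
pose z (i : 'I_(size r)) := r`_i.
have zr i : z i \in r by rewrite mem_nth.
have [|c [i0 ci0] c0] :=
  @lin_dep K 'I_(size r) {: 'X_{1..n < b}} (fun i m => (q (z i))@_m).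
  by rewrite card_ord.
have cq0 : \sum_i c i *: q (z i) = 0.
  transitivity (\sum_i \sum_(m : 'X_{1..n < b}) (c i * (q (z i))@_m) *: 'X_[m]
      : {mpoly K[n]}).
    apply: eq_bigr => i _; rewrite {1}(mpolywE (qb _ (zr i))) scaler_sumr.
    by apply: eq_bigr => m _; rewrite scalerA.
  rewrite exchange_big big1 //= => m _.
  by rewrite -scaler_suml c0 scale0r.
exists (\sum_i c i *: \prod_(j | j != i) ('X - (z j)%:P)).
  (* At [z i0] every summand but that of [i0] vanishes, and that one does not, since [r] has no
     repetitions. *)
  apply/eqP => /(congr1 (fun p => p.[z i0])); rewrite horner0 horner_sum.
  rewrite (bigD1 i0) //= [X in _ + X]big1 ?addr0 => [|i i_neq]; last first.
    rewrite hornerZ horner_prod (bigD1 i0) 1?eq_sym //= hornerXsubC subrr mul0r.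
    by rewrite mulr0.
  rewrite hornerZ horner_prod; apply/eqP; rewrite mulf_neq0 //.
  apply/prodf_neq0 => j j_neq; rewrite hornerXsubC subr_eq0.
  by rewrite nth_uniq // eq_sym.
pose P := \prod_j (u - (z j)%:A).
have PE i : P = (u - (z i)%:A) * \prod_(j | j != i) (u - (z j)%:A).
  by rewrite /P (bigD1 i).
rewrite raddf_sum /=.
(* Subtracting the linear relation times [P], which is zero, makes each summand a multiple of some
   [1 - q (z i) * (u - (z i)%:A)], an element of [J]. *)
have -> : \sum_i horner_alg u (c i *: \prod_(j | j != i) ('X - (z j)%:P)) =
  \sum_i c i *: ((\prod_(j | j != i) (u - (z j)%:A)) * (1 - q (z i) * (u - (z i)%:A))).
  have cqP0 : \sum_i c i *: q (z i) * P = 0 by rewrite -mulr_suml cq0 mul0r.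
  rewrite -[LHS]subr0 -[X in _ - X]cqP0 -sumrB.
  apply: eq_bigr => i _; rewrite linearZ /= rmorph_prod /=.
  rewrite (eq_bigr (fun j => u - (z j)%:A)) => [|j _]; last first.
    by rewrite rmorphB /= horner_algX horner_algC.
  rewrite mulr_algl -scalerAl -scalerBr mulrBr mulr1; congr (_ *: (_ - _)).
  by rewrite (PE i) mulrA mulrC.
apply: ideal_sum => // i; apply: idealZ => //.
by have [_ _ JM] := idJ; apply/JM/Jq.
Qed.

(** Some size bound [b] holds for the inverses of infinitely many shifts, so p(u) lies in [J] for
    some nonzero [p]. Over a closed field [p] splits into linear factors; those with nonzero root
    are invertible modulo [J], and a power of [u] remains. *)
Lemma ideal_shift_unit (K : closedFieldType) n (J : {mpoly K[n]} -> Prop) u :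
  ~ countable [set: K] -> ideal J ->
  (forall z, z != 0 -> adjoin J (u - z%:A) 1) -> exists t, J (u ^+ t).
Proof.
move=> Kunc idJ inv.
have /choice[q Jq] : forall z, exists a, z != 0 -> J (1 - a * (u - z%:A)).
  by move=> z; have [->|/inv[a Ja]] := eqVneq z 0; [exists 0 | exists a].
pose A b := [set z : K | z != 0 /\ (msize (q z) <= b)%N]%classic.
have [b infA] : exists b, infinite_set (A b).
  apply: contrapT => N; apply: Kunc.
  (* If every [A b] were finite, [K] would be the union of {0} and countably many finite sets. *)
  apply: (@sub_countable _ _ _ ([set 0] `|` \bigcup_b (A b))%classic).
    apply: subset_card_le => z _; have [->|z0] := eqVneq z 0; first by left.
    by right; exists (msize (q z)).
  rewrite -bigcup2inE; apply: bigcup_countable => // -[|[|i]] //= _.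
  apply: bigcup_countable => // b _; apply: finite_set_countable.
  by apply: contrapT => Ab; apply: N; exists b.
have [B BA Bsz] := infinite_set_fset #|{: 'X_{1..n < b}}|.+1 infA.
have [||||p p0 Jp] := @ideal_shift_dep K n J u (enum_fset B) q b idJ.
- exact: fset_uniq.
- by move=> z zB; have [z0 _] := BA z zB; apply: Jq.
- by move=> z zB; have [_] := BA z zB.
- exact: Bsz.
have [s Ep] := closed_field_poly_normal p.
apply: (@ideal_prod_shift _ _ J u s 0) => //.
rewrite mulr1.
have -> : \prod_(z <- s) (u - z%:A) = (lead_coef p)^-1 *: horner_alg u p.
  rewrite [in horner_alg u p]Ep linearZ /= mulr_algl scalerA mulVf ?lead_coef_eq0 //.
  rewrite scale1r rmorph_prod; apply: eq_bigr => z _.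
  by rewrite rmorphB /= horner_algX horner_algC.
exact: idealZ.
Qed.

(** Otherwise a power of [u] lies in [J], while the shift by 0 makes [u] itself invertible modulo
    [J]; together these put 1 in [J]. *)
Lemma ideal_shift_proper (K : closedFieldType) n (J : {mpoly K[n]} -> Prop) u :
  ~ countable [set: K] -> ideal J -> ~ J 1 ->
  exists z, ~ adjoin J (u - z%:A) 1.
Proof.
move=> Kunc idJ J1; have [J0 JD JM] := idJ; apply: contrapT => N.
have inv z : adjoin J (u - z%:A) 1 by apply: contrapT => ?; apply: N; exists z.
have [t Jt] := ideal_shift_unit Kunc idJ (fun z _ => inv z).
have [a] := inv 0; rewrite scale0r subr0 => Ja; apply: J1.
have -> : 1 = (1 - (a * u) ^+ t) + a ^+ t * u ^+ t by rewrite exprMn subrK.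
apply: JD; last exact: JM.
rewrite -{1}(expr1n _ t) subrXX mulrC; exact: JM.
Qed.

(** Congruence modulo [J] to a constant is preserved by sums and products, so reduction modulo [J]
    is evaluation at [v]. *)
Lemma ideal_point (K : fieldType) n (J : {mpoly K[n]} -> Prop) (v : 'I_n -> K) :
  ideal J -> (forall i, J ('X_i - (v i)%:A)) -> forall p, J (p - (p.@[v])%:A).
Proof.
move=> idJ Jv p; have [J0 JD JM] := idJ.
have JMM (a b : {mpoly K[n]}) x y :
    J (a - x%:A) -> J (b - y%:A) -> J (a * b - (x * y)%:A).
  move=> Ja Jb; have -> : a * b - (x * y)%:A = b * (a - x%:A) + x%:A * (b - y%:A).
    rewrite !mulrBr -!scalerAl !mul1r scalerA [b * a]mulrC addrA; congr (_ - _).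
    by rewrite [b * _]mulrC mulr_algl subrK.
  by apply: JD; apply: JM.
rewrite {1}(mpolyE p) mevalE scaler_suml -sumrB.
apply: (big_ind J) => // m _.
rewrite -scalerA -scalerBr; apply: idealZ => //.
rewrite mpolyXE_id; apply: (big_ind2 (fun a x => J (a - x%:A))) => //.
- by rewrite scale1r subrr.
- by move=> a x b y; apply: JMM.
move=> i _; elim: (m i) => [|k IHk]; first by rewrite !expr0 scale1r subrr.
by rewrite !exprS; apply: JMM.
Qed.

(** Since no power of ['X_i] lies in [J], some ['X_i - z%:A] with [z] nonzero can be adjoined
    without reaching 1. Then some ['X_j - x%:A] is adjoined for each variable in turn, and the
    resulting proper ideal [L] is that of a point [v]. *)
Lemma nullstellensatz (K : closedFieldType) n (J : {mpoly K[n]} -> Prop) i :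
  ~ countable [set: K] -> ideal J -> (forall t, ~ J ('X_i ^+ t)) ->
  exists2 v : 'I_n -> K, v i != 0 & forall p, J p -> p.@[v] = 0.
Proof.
move=> Kunc idJ Ji.
have [z z0 J1] : exists2 z, z != 0 & ~ adjoin J ('X_i - z%:A) 1.
  apply: contrapT => N.
  have [|t] := ideal_shift_unit (u := 'X_i) Kunc idJ; last exact: Ji.
  by move=> z z0; apply: contrapT => ?; apply: N; exists z.
have ext (s : seq 'I_n) (L : {mpoly K[n]} -> Prop) : ideal L -> ~ L 1 ->
    exists L', [/\ ideal L', ~ L' 1, forall p, L p -> L' p
      & forall j, j \in s -> exists x, L' ('X_j - x%:A)].
  elim: s L => [|j s IHs] L idL L1; first by exists L.
  have [x Lx] := ideal_shift_proper 'X_j Kunc idL L1.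
  have [L' [idL' L'1 LL' L's]] := IHs _ (ideal_adjoin ('X_j - x%:A) idL) Lx.
  have [L0 _ _] := idL.
  exists L'; split=> // [p Lp|k].
    by apply: LL'; exists 0; rewrite mul0r subr0.
  rewrite inE => /predU1P[->|]; last exact: L's.
  by exists x; apply: LL'; exists 1; rewrite mul1r subrr.
have [L [idL L1 JL Ls]] := ext (enum 'I_n) _ (ideal_adjoin ('X_i - z%:A) idJ) J1.
have /choice[v Lv] : forall j, exists x, L ('X_j - x%:A).
  by move=> j; apply: Ls; rewrite mem_enum.
have const x : L x%:A -> x = 0.
  move=> Lx; apply/eqP/contraT => x0; case: L1.
  by rewrite -(scale1r 1) -(mulVf x0) -scalerA; apply: idealZ.
exists v => [|p Jp].
  (* The choice of [v i] was made afresh among the [x] with ['X_i - x%:A] in [L]; it agrees with [z]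
     because [L] contains no nonzero constant. *)
  suff -> : v i = z by [].
  apply/eqP; rewrite -subr_eq0; apply/eqP/const.
  have -> : (v i - z)%:A = ('X_i - z%:A) - ('X_i - (v i)%:A) :> {mpoly K[n]}.
    by rewrite scalerBl; ring.
  apply: idealB => //.
  by apply: JL; exists 1; have [J0 _ _] := idJ; rewrite mul1r subrr.
apply: const; rewrite -[_%:A](subKr p); apply: idealB => //.
  by apply: JL; exists 0; rewrite mul0r subr0.
exact: ideal_point.
Qed.

(** * Uncountability of the real and complex numbers *)

(** Cantor's nested intervals: the [n]-th step passes to a closed subinterval that avoids [g n]. The
    supremum of the left endpoints lies in all the intervals, yet it is a value of [g]. *)
Lemma realType_uncountable (R : realType) : ~ countable [set: R].
Proof.
move=> /countable_injP[f f_inj]; pose g n : R := xget 0 [set x | f x = n]%classic.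
have gf x : g (f x) = x.
  by apply: f_inj; rewrite ?in_setT // (@xgetPex _ 0 [set y | f y = f x]%classic) //; exists x.
(* The right-hand choice starts at the midpoint of [m] and [I.2], strictly beyond [m], so that the
   closed interval misses [g n] even when it equals [m]. *)
pose step n (I : R * R) := let m := (I.1 + I.2) / 2 in
  if g n <= m then ((m + I.2) / 2, I.2) else (I.1, m).
pose I := fix I n := if n is n'.+1 then step n' (I n') else (0, 1).
have stepP n J : J.1 < J.2 -> [/\ (step n J).1 < (step n J).2,
    J.1 <= (step n J).1, (step n J).2 <= J.2 &
    ~~ ((step n J).1 <= g n <= (step n J).2)].
  case: J => a b /= ab; rewrite /step /=; case: (leP (g n)) => /= gm; split; lra.
have I_lt n : (I n).1 < (I n).2.
  by elim: n => [|n IHn] /=; [exact: ltr01 | have [] := stepP n _ IHn].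
have I_sub i j : (i <= j)%N -> (I i).1 <= (I j).1 /\ (I j).2 <= (I i).2.
  elim: j => [|j IHj]; first by rewrite leqn0 => /eqP->.
  rewrite leq_eqVlt => /predU1P[->//|/IHj[le1 le2]].
  have [_ le3 le4 _] := stepP j _ (I_lt j).
  by split; [exact: le_trans le3 | exact: le_trans le2].
pose A := [set (I n).1 | n in [set: nat]]%classic.
have ubA n : ubound A (I n).2.
  move=> _ [k _ <-]; have [/I_sub[_ le2]|/ltnW/I_sub[le1 _]] := leqP n k.
    exact: le_trans (ltW (I_lt k)) le2.
  exact: le_trans le1 (ltW (I_lt n)).
have supA : has_sup A by split; [exists (I 0%N).1; exists 0%N | exists (I 0%N).2].
have [_ _ _] := stepP (f (sup A)) _ (I_lt (f (sup A))).
rewrite gf -/(I (f (sup A)).+1) => /negP[]; apply/andP; split.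
  by apply: ub_le_sup; [exact: supA.2 | exists (f (sup A)).+1].
by apply: ge_sup; [exact: supA.1 | exact: (ubA (f (sup A)).+1)].
Qed.

Lemma complex_uncountable (R : realType) : ~ countable [set: R[i]%C].
Proof.
move=> /countable_injP[f f_inj]; apply: (@realType_uncountable R).
apply/countable_injP; exists (fun x => f (x%:C)%C) => x y _ _ fxy.
by have [] : (x%:C)%C = (y%:C)%C by apply: f_inj; rewrite ?in_setT.
Qed.

(** * Linear forms and homogeneous components *)

Lemma mpolyX_neq0 (K : nzRingType) N (x : 'X_{1..N}) : 'X_[x] != 0 :> {mpoly K[N]}.
Proof. by rewrite -msize_poly_eq0 msizeX. Qed.

Definition lform (K : nzRingType) N (b v : 'I_N -> K) : K := \sum_c b c * v c.

Definition lform_mpoly (K : nzRingType) N (b : 'I_N -> K) : {mpoly K[N]} :=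
  \sum_c b c *: 'X_c.

Lemma meval_lform (K : comNzRingType) N (b v : 'I_N -> K) :
  (lform_mpoly b).@[v] = lform b v.
Proof.
by rewrite raddf_sum; apply: eq_bigr => c _; rewrite /= mevalZ mevalXU.
Qed.

Lemma meval_scale (K : comNzRingType) N (p : {mpoly K[N]}) v a :
  p.@[fun c => a * v c] =
  (\sum_(m <- msupp p) (p@_m * 'X_[m].@[v]) *: 'X^(mdeg m)).[a].
Proof.
rewrite mevalE horner_sum; apply: eq_bigr => m _.
rewrite hornerZ hornerXn mevalX -mulrA; congr (_ * _).
by rewrite mulrC mdegE -prodrXr -big_split; apply: eq_bigr => c _; rewrite exprMn.
Qed.

Lemma meval_pihomog (K : comNzRingType) N d (p : {mpoly K[N]}) v :
  (pihomog mdeg d p).@[v] =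
  (\sum_(m <- msupp p) (p@_m * 'X_[m].@[v]) *: 'X^(mdeg m))`_d.
Proof.
rewrite pihomogE raddf_sum coef_sum /= big_mkcond; apply: eq_bigr => m _.
rewrite coefZ coefXn eq_sym; case: eqP => _; last by rewrite mulr0.
by rewrite mulr1 mevalZ.
Qed.

Lemma msize_pihomog (K : comNzRingType) N d (p : {mpoly K[N]}) :
  (msize (pihomog mdeg d p) <= d.+1)%N.
Proof.
rewrite msizeE; apply/bigmax_leqP_seq => m mp _.
by have /dhomogP/(_ m mp) -> := pihomogP mdeg d p.
Qed.

(** Both sides are polynomials in [a]; the coefficients of a^(t+1) are compared. The factor
    [a * l i] supplies one degree, so only the component of degree [t] of [g i] contributes. *)
Lemma homog_component_eq (K : numFieldType) N m (v : 'I_N -> K)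
    (l : 'I_m -> K) (g : 'I_m -> {mpoly K[N]}) t x :
  (forall a, a ^+ t.+1 * x =
     \sum_i (g i).@[fun c => a * v c] * (a * l i)) ->
  x = \sum_i (pihomog mdeg t (g i)).@[v] * l i.
Proof.
move=> E; pose q i :=
  \sum_(m <- msupp (g i)) ((g i)@_m * 'X_[m].@[v]) *: 'X^(mdeg m).
have : x *: 'X^(t.+1) - \sum_i l i *: (q i * 'X) = 0.
  apply: poly_eq0_horner => a; rewrite hornerD hornerN hornerZ hornerXn.
  rewrite mulrC E horner_sum -sumrB big1 // => i _.
  by rewrite hornerZ hornerMX meval_scale -/(q i); ring.
move=> /(congr1 (fun p : {poly K} => p`_(t.+1))).
rewrite coefB coefZ coefXn eqxx mulr1 coef0 coef_sum => /eqP.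
rewrite subr_eq0 => /eqP ->; apply: eq_bigr => i _.
by rewrite coefZ coefMX /= mulrC meval_pihomog.
Qed.

(** * Finiteness of the coordinate ring of a cone over linear forms without common nonzero zero *)

Section Cone.
Variables (K : numClosedFieldType) (N m : nat).
Variables (V : ('I_N -> K) -> Prop) (b : 'I_m -> 'I_N -> K).
Hypothesis K_unc : ~ countable [set: K].
Hypothesis V_cone : forall a v, V v -> V (fun c => a * v c).
Hypothesis V_closed : forall v,
  (forall p : {mpoly K[N]}, (forall w, V w -> p.@[w] = 0) -> p.@[v] = 0) -> V v.
Hypothesis V_zero :
  forall v, V v -> (forall i, lform (b i) v = 0) -> forall c, v c = 0.

Let ell (v : 'I_N -> K) (i : 'I_m) := lform (b i) v.

(** [J] is the ideal I(V) + (l_i). Its common zeros lie in [V] by [V_closed], hence are 0 by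
    [V_zero], so the Nullstellensatz puts a power of ['X_c] in [J]. Homogeneity then bounds the
    coefficients. *)
Lemma cone_power c : exists t (g : 'I_m -> {mpoly K[N]}),
  [/\ (0 < t)%N, forall i, (msize (g i) <= t)%N &
      forall v, V v -> v c ^+ t = \sum_i (g i).@[v] * ell v i].
Proof.
pose J (p : {mpoly K[N]}) := exists g : 'I_m -> {mpoly K[N]},
  forall v, V v -> p.@[v] = \sum_i (g i).@[v] * ell v i.
have idJ : ideal J.
  split=> [|p q [g gp] [h hq]|a p [g gp]].
  - by exists (fun _ => 0) => v _; rewrite meval0 big1 // => i _; rewrite ?meval0 mul0r.
  - exists (fun i => g i + h i) => v Vv; rewrite mevalD gp // hq // -big_split.
    by apply: eq_bigr => i _; rewrite mevalD mulrDl.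
  - exists (fun i => a * g i) => v Vv; rewrite mevalM gp // mulr_sumr.
    by apply: eq_bigr => i _; rewrite mevalM mulrA.
have [t [g gt]] : exists t, J ('X_c ^+ t).
  apply: contrapT => N0.
  have [|v vc0 Jv] := nullstellensatz K_unc idJ (i := c).
    by move=> t Jt; apply: N0; exists t.
  have Vv : V v.
    apply: V_closed => p pV; apply: Jv; exists (fun _ => 0) => w Vw.
    by rewrite pV // big1 // => i _; rewrite ?meval0 mul0r.
  case/eqP: vc0; apply: V_zero => // i; rewrite -meval_lform; apply: Jv.
  exists (fun j => (j == i)%:R) => w Vw; rewrite (bigD1 i) //= eqxx meval1 mul1r.
  rewrite big1 ?addr0 => [|j /negPf->]; first by rewrite meval_lform.
  by rewrite ?meval0 mul0r.
(* The extra factor ['X_c] makes the exponent positive; the component of degree [t] has [msize] at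
   most [t.+1], as required. *)
exists t.+1, (fun i => pihomog mdeg t ('X_c * g i)); split=> // [i|v Vv].
  exact: msize_pihomog.
apply: homog_component_eq => a; rewrite -exprMn.
have := gt _ (V_cone a Vv); rewrite rmorphXn /= mevalXU => E.
rewrite exprS E mulr_sumr; apply: eq_bigr => i _.
rewrite mevalM mevalXU mulrA; congr (_ * _).
by rewrite /ell /lform mulr_sumr; apply: eq_bigr => j _; rewrite mulrCA.
Qed.

(** On [V], [p] is a combination of the finitely many monomials with all exponents below [T], with
    coefficients of degree at most [s] in the forms: these monomials are the module generators. *)
Let rep T s (p : {mpoly K[N]}) :=
  exists G : {ffun 'I_N -> 'I_T} -> {mpoly K[m]},
  (forall x, (msize (G x) <= s.+1)%N) /\
  (forall v, V v ->
    p.@[v] = \sum_x 'X_[ffun_mnm x].@[v] * (G x).@[ell v]).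

Let rep_sum T s (I : Type) (r : seq I) (P : pred I) F :
  (forall i, P i -> rep T s (F i)) -> rep T s (\sum_(i <- r | P i) F i).
Proof.
move=> Fr; apply: big_ind => // [|p q [G [Gs GE]] [H [Hs HE]]].
  exists (fun _ => 0); split=> [x|v _]; first by rewrite msize0.
  by rewrite meval0 big1 // => x _; rewrite ?meval0 mulr0.
exists (fun x => G x + H x); split=> [x|v Vv].
  by apply: leq_trans (msizeD_le _ _) _; rewrite geq_max Gs Hs.
rewrite mevalD GE // HE // -big_split; apply: eq_bigr => x _.
by rewrite mevalD mulrDr.
Qed.

Let repZ T s a p : rep T s p -> rep T s (a *: p).
Proof.
move=> [G [Gs GE]]; exists (fun x => a *: G x); split=> [x|v Vv].
  exact: leq_trans (mmeasureZ_le _ _ _) (Gs x).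
rewrite mevalZ GE // mulr_sumr; apply: eq_bigr => x _.
by rewrite mevalZ mulrCA.
Qed.

Let rep_lform T s i p : rep T s p -> rep T s.+1 (p * lform_mpoly (b i)).
Proof.
move=> [G [Gs GE]]; exists (fun x => G x * 'X_i); split=> [x|v Vv].
  have [->|G0] := eqVneq (G x) 0; first by rewrite mul0r msize0.
  by rewrite msizeM ?mpolyX_neq0 // msizeX mdeg1 addn2 /= ltnS Gs.
rewrite mevalM meval_lform GE // mulr_suml; apply: eq_bigr => x _.
by rewrite mevalM mevalXU mulrA.
Qed.

Let rep_eq T s p q : (forall v, V v -> p.@[v] = q.@[v]) -> rep T s q -> rep T s p.
Proof.
by move=> pq [G [Gs GE]]; exists G; split=> // v Vv; rewrite pq // GE.
Qed.

(** A monomial with some exponent at least [t c] is rewritten by [cone_power]: the cofactors of the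
    forms have smaller degree, and induction applies. The other monomials are generators, [T] being
    the largest [t c]. *)
Lemma cone_rep : exists T, forall s p, (msize p <= s.+1)%N -> rep T s p.
Proof.
have /choice[t /choice[g tg]] := cone_power.
pose T := (\max_c t c)%N; exists T => s; elim/ltn_ind: s => s IHs p ps.
rewrite (mpolyE p) big_seq; apply: rep_sum => x xp; apply: repZ.
have xs : (mdeg x <= s)%N by rewrite -ltnS (leq_trans (msize_mdeg_lt xp)).
have [c tx|lt_xt] := pickP (fun c => t c <= x c)%N; last first.
  have xT c : (x c < T)%N.
    by apply: leq_trans (leq_bigmax c); rewrite ltnNge lt_xt.
  pose x' := [ffun c => Ordinal (xT c)].
  have xE : ffun_mnm x' = x by apply/mnmP => c; rewrite mnmE ffunE.
  exists (fun y => (y == x')%:R); split=> [y|v _].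
    by case: (_ == _); rewrite ?msize1 ?msize0.
  rewrite (bigD1 x') //= eqxx meval1 mulr1 xE big1 ?addr0 // => y /negPf->.
  by rewrite ?meval0 mulr0.
have [t0 gt gE] := tg c.
pose x' := (x - U_(c) *+ t c)%MM.
have xE : x = (x' + U_(c) *+ t c)%MM.
  rewrite submK //; apply/mnm_lepP => i; rewrite mulmnE mnm1E.
  by case: eqP => [<-|_]; rewrite ?mul1n ?mul0n.
have dx : mdeg x = (mdeg x' + t c)%N by rewrite {1}xE mdegD mdegMn mdeg1 mul1n.
apply: (@rep_eq _ _ _ (\sum_i 'X_[x'] * g c i * lform_mpoly (b i))).
  move=> v Vv; rewrite xE mpolyXD -mpolyXn mevalM rmorphXn /= mevalXU gE //.
  rewrite raddf_sum mulr_sumr; apply: eq_bigr => i _.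
  by rewrite /= !mevalM meval_lform mulrA.
(* Degree 0 is excluded here, because [mdeg x] is at least [t c], which is positive. *)
apply: rep_sum => i _; case: s xs IHs {ps} => [|s] xs IHs; first by lia.
apply: rep_lform; apply: IHs => //.
have [->|g0] := eqVneq (g c i) 0; first by rewrite mulr0 msize0.
rewrite msizeM ?mpolyX_neq0 // msizeX.
by have := gt i; move: (msize _) => z; lia.
Qed.

(** The (s+1)^D monomials in the chosen coordinates have coefficient families in a space of
    dimension at most T^N (D s + 1)^m, which is smaller for a suitable [s]. A linear relation
    between these families is a relation on [V]. *)
Lemma cone_alg_dep D (y : 'I_D -> 'I_N) : (m < D)%N ->
  exists2 F : {mpoly K[D]}, F != 0 &
    forall v, V v -> F.@[fun j => v (y j)] = 0.
Proof.
move=> lt_mD; have [T repT] := cone_rep.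
have [s lt_s] := expn_growth D (T ^ N) lt_mD.
pose mon (a : {ffun 'I_D -> 'I_s.+1}) : {mpoly K[N]} := \prod_j 'X_(y j) ^+ a j.
have /choice[G GP] a : rep T (1 * D * s) (mon a).
  by apply/repT/msize_prod_exp => j; rewrite msizeX mdeg1.
rewrite mul1n in GP.
have [|c [a0 ca0] c0] := @lin_dep K {ffun 'I_D -> 'I_s.+1}
    ({ffun 'I_N -> 'I_T} * 'X_{1..m < (D * s).+1})%type (fun a z => (G a z.1)@_z.2).
  rewrite card_prod !card_ffun !card_ord; apply: leq_ltn_trans lt_s.
  by rewrite leq_mul2l card_bmultinom orbT.
exists (\sum_a c a *: 'X_[ffun_mnm a]); first exact: ffun_mpoly_neq0 ca0.
move=> v Vv; rewrite raddf_sum /=.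
transitivity (\sum_a \sum_x \sum_(z : 'X_{1..m < (D * s).+1})
    'X_[ffun_mnm x].@[v] * 'X_[z].@[ell v] * (c a * (G a x)@_z)).
  apply: eq_bigr => a _; rewrite mevalZ.
  have -> : 'X_[ffun_mnm a].@[fun j => v (y j)] = (mon a).@[v].
    rewrite mevalX rmorph_prod; apply: eq_bigr => j _.
    by rewrite mnmE rmorphXn /= mevalXU.
  have [Gs ->] // := GP a; rewrite mulr_sumr; apply: eq_bigr => x _.
  rewrite (meval_bounded (Gs x)) !mulr_sumr; apply: eq_bigr => z _.
  by ring.
rewrite exchange_big big1 //= => x _; rewrite exchange_big big1 //= => z _.
by rewrite -mulr_sumr (c0 (x, z)) mulr0.
Qed.

End Cone.

(** * Matrices as points: the variety of matrices of bounded rank and its charts *)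

Definition mxpoint (K : nmodType) n (X : 'M[K]_n) : 'I_(n * n) -> K :=
  fun c => mxvec X ord0 c.

Definition mx_of_point (K : nmodType) n (v : 'I_(n * n) -> K) : 'M[K]_n :=
  vec_mx (\row_c v c).

Lemma mxpointK (K : nmodType) n (X : 'M[K]_n) : mx_of_point (mxpoint X) = X.
Proof.
by rewrite -[RHS]mxvecK; congr vec_mx; apply/rowP => c; rewrite mxE.
Qed.

Lemma mxrank_mxsub (K : fieldType) n p q (f : 'I_p -> 'I_n) (g : 'I_q -> 'I_n)
  (A : 'M[K]_n) : (\rank (mxsub f g A) <= \rank A)%N.
Proof.
have rowle m1 m2 m3 (h : 'I_m1 -> 'I_m2) (B : 'M[K]_(m2, m3)) :
    (\rank (rowsub h B) <= \rank B)%N.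
  exact/mxrankS/rowsub_sub.
rewrite [mxsub f g A](_ : _ = rowsub f (colsub g A)); last by apply/matrixP => i j; rewrite !mxE.
apply: leq_trans (rowle _ _ _ _ _) _.
by rewrite -mxrank_tr trmx_mxsub -[in leqRHS]mxrank_tr; apply: rowle.
Qed.

(** If [A] had rank above [k], some minor of size [\rank A] would be nonzero at [A]; as a polynomial
    it vanishes on all matrices of rank at most [k]. *)
Lemma rank_le_closed (K : fieldType) n k (v : 'I_(n * n) -> K) :
  (forall p : {mpoly K[n * n]},
     (forall w, (\rank (mx_of_point w) <= k)%N -> p.@[w] = 0) -> p.@[v] = 0) ->
  (\rank (mx_of_point v) <= k)%N.
Proof.
set A := mx_of_point v => Av; rewrite leqNgt; apply/negP => lt_kA.
pose f := maxrankfun A.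
have fullB : row_full (rowsub f A)^T by rewrite /row_full mxrank_tr; apply: maxrowsub_free.
pose g := fullrankfun fullB.
pose M := \matrix_(i, j) 'X_(mxvec_index (f i) (g j)) : 'M[{mpoly K[n * n]}]_(\rank A).
have ME w : (\det M).@[w] = \det (mxsub f g (mx_of_point w)).
  rewrite -det_map_mx; congr (\det _); apply/matrixP => i j.
  by rewrite !mxE /= mevalXU.
have : mxsub f g A \in unitmx.
  rewrite -unitmx_tr; have := fullrowsub_unit fullB.
  by congr (_ \in unitmx); apply/matrixP => i j; rewrite !mxE.
rewrite unitmxE -ME Av ?unitr0 // => w wk; rewrite ME; apply/eqP/contraT.
rewrite -unitfE -unitmxE => /mxrank_unit rk.
have := leq_trans (mxrank_mxsub f g (mx_of_point w)) wk.
by rewrite rk leqNgt lt_kA.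
Qed.

(* Entries in the first k rows or the first k columns of a matrix of rank at
   most k are free as soon as the leading k x k block is invertible. *)
Lemma rank_le_alg_indep (K : numFieldType) k l :
  exists (y : 'I_(k * k + k * l + l * k) -> 'I_((k + l) * (k + l))),
  forall F : {mpoly K[k * k + k * l + l * k]},
    (forall X : 'M[K]_(k + l), (\rank X <= k)%N ->
       F.@[fun j => mxpoint X (y j)] = 0) -> F = 0.
Proof.
pose T := ('I_k * 'I_k + 'I_k * 'I_l + 'I_l * 'I_k)%type.
have cardT : #|{: T}| = (k * k + k * l + l * k)%N.
  by rewrite !card_sum !card_prod !card_ord.
rewrite -cardT.
pose pos (t : T) : 'I_((k + l) * (k + l)) := match t with
  | inl (inl (i, j)) => mxvec_index (lshift l i) (lshift l j)
  | inl (inr (i, j)) => mxvec_index (lshift l i) (rshift k j)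
  | inr (i, j) => mxvec_index (rshift k i) (lshift l j) end.
exists (fun j => pos (enum_val j)) => F F0; apply/eqP/contraT => FN0.
pose P := \det (\matrix_(i < k, j < k)
  'X_(enum_rank (inl (inl (i, j)) : T)) : 'M[{mpoly K[#|{: T}|]}]_k).
have PE u : P.@[u] = \det (\matrix_(i < k, j < k) u (enum_rank (inl (inl (i, j)) : T))).
  rewrite -det_map_mx; congr (\det _); apply/matrixP => i j.
  by rewrite !mxE /= mevalXU.
have PN0 : P != 0.
  apply/eqP => P0; have := PE (fun c => if enum_val c is inl (inl (i, j))
    then (i == j)%:R else 0).
  rewrite P0 meval0 (_ : \matrix_(_, _) _ = 1%:M) ?det1; last first.
    by apply/matrixP => i j; rewrite !mxE enum_rankK.
  by move=> /esym/eqP; rewrite oner_eq0.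
(* At this [u] both [F] and the determinant of the leading block are nonzero. The three blocks read
   off from [u] are completed by W3 W1^-1 W2 to a matrix that factors through dimension [k]. *)
have [u] := mpoly_meval_neq0 (mulf_neq0 FN0 PN0).
rewrite mevalM mulf_eq0 negb_or PE => /andP[Fu Pu].
set W1 := \matrix_(i, j) _ in Pu.
have W1u : W1 \in unitmx by rewrite unitmxE unitfE.
pose W2 := \matrix_(i < k, j < l) u (enum_rank (inl (inr (i, j)) : T)).
pose W3 := \matrix_(i < l, j < k) u (enum_rank (inr (i, j) : T)).
pose X := col_mx W1 W3 *m row_mx 1%:M (invmx W1 *m W2).
have XE : X = block_mx W1 W2 W3 (W3 *m invmx W1 *m W2).
  by rewrite /X mul_col_row !mulmx1 mulKVmx // mulmxA.
case/eqP: Fu; rewrite -(F0 X) ?mulmx_max_rank //; apply: meval_eq => c.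
rewrite /mxpoint -[c in LHS]enum_valK.
by case: (enum_val c) => [[[i j]|[i j]]|[i j]] /=;
  rewrite mxvecE XE ?block_mxEul ?block_mxEur ?block_mxEdl mxE.
Qed.

(** Otherwise [cone_alg_dep] would make the independent coordinates of [rank_le_alg_indep] dependent
    on the cone; with l = n - k their number is k k + k l + l k = n^2 - (n-k)^2. *)
Lemma rank_le_meets_kernel (K : numClosedFieldType) n k m (b : 'I_m -> 'M[K]_n) :
  ~ countable [set: K] -> (k <= n)%N -> (m < n * n - (n - k) * (n - k))%N ->
  exists X : 'M[K]_n, [/\ X != 0, (\rank X <= k)%N &
    forall i, lform (mxpoint (b i)) (mxpoint X) = 0].
Proof.
move=> Kunc le_kn; have [l En] : exists l, n = (k + l)%N by exists (n - k)%N; lia.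
rewrite {}En in b *.
have -> : ((k + l) * (k + l) - (k + l - k) * (k + l - k) = k * k + k * l + l * k)%N.
  by nia.
move=> lt_m; have [y yP] := rank_le_alg_indep K k l.
apply: contrapT => N.
pose V (v : 'I_((k + l) * (k + l)) -> K) := (\rank (mx_of_point v) <= k)%N.
have Vcone a v : V v -> V (fun c => a * v c).
  apply: leq_trans; apply: mxrankS.
  rewrite (_ : mx_of_point (fun c => a * v c) = a *: mx_of_point v) ?scalemx_sub //.
  by apply/matrixP => i j; rewrite !mxE.
have [|F FN0 F0] := @cone_alg_dep K _ m V (fun i => mxpoint (b i)) Kunc Vcone
    (@rank_le_closed _ _ _) _ _ y lt_m.
- move=> v Vv bv c; apply: contrapT => vc; apply: N; exists (mx_of_point v).
  have vE : mxpoint (mx_of_point v) = v.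
    by apply/funext => d; rewrite /mxpoint /mx_of_point vec_mxK mxE.
  split=> // [|i]; last by rewrite vE.
  by apply/eqP => v0; apply: vc; rewrite -vE v0 /mxpoint linear0 mxE.
- case/eqP: FN0; apply: yP => X Xk; apply: F0.
  by rewrite /V mxpointK.
Qed.

(* Dimension count on a chart: an m-tuple of matrices annihilating a matrix
   X = Z *m W with rows f of Z forming the identity and W a0 b = 1 is determined
   by the other entries of Z and W and by the entries of the matrices of the
   tuple outside position (f a0, b), where X has entry 1. *)
Lemma chart_alg_dep (K : fieldType) n m j (f : 'I_j -> 'I_n) (a0 : 'I_j) (b0 : 'I_n) :
  injective f -> ((n - j) * j + j * n <= m)%N ->
  exists2 F : {mpoly K[m * (n * n)]}, F != 0 &
    forall (A : 'I_m -> 'M[K]_n) (Z : 'M_(n, j)) (W : 'M_(j, n)),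
      rowsub f Z = 1%:M -> W a0 b0 = 1 ->
      (forall i, lform (mxpoint (A i)) (mxpoint (Z *m W)) = 0) ->
      F.@[tuple_point A ord0] = 0.
Proof.
move=> f_inj le_m; pose q0 := mxvec_index (f a0) b0.
pose Q := {q : 'I_(n * n) | q != q0}.
pose T := ({i : 'I_n | i \notin codom f} * 'I_j +
  {p : 'I_j * 'I_n | p != (a0, b0)} + 'I_m * Q)%type.
(* The count is (n-j) j + (j n - 1) + m (n^2 - 1), less than m n^2 by [le_m]. *)
have cardT : (#|{: T}| < m * (n * n))%N.
  have cardN : (#|[pred i | i \notin codom f]| = n - j)%N.
    have cardA : (#|codom f| + #|[predC codom f]| = n)%N.
      by rewrite -[RHS](card_ord n); apply: cardC.
    apply/esym; rewrite -[X in (X - _)%N]cardA card_codom // card_ord addKn.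
    exact: eq_card.
  rewrite !card_sum !card_prod !card_sig !card_ord cardN.
  have := cardC1 (a0, b0); have := cardC1 q0.
  rewrite card_prod !card_ord => -> ->.
  have j0 : (0 < j)%N by apply: leq_ltn_trans (ltn_ord a0).
  have n0 : (0 < n)%N by apply: leq_ltn_trans (ltn_ord b0).
  have : (0 < j * n)%N by rewrite muln_gt0 j0.
  have : (0 < n * n)%N by rewrite muln_gt0 n0.
  move: (j * n)%N (n * n)%N le_m => x y; case: y => // y le_m _ x0 /=.
  by rewrite mulnS; move: (m * y)%N => z; lia.
pose S := {mpoly K[#|{: T}|]}; pose xi (t : T) : S := 'X_(enum_rank t).
(* The rows of [Zp] in the image of [f] are those of the identity, and [Wp] has the entry 1 at
   [(a0, b0)]; all other entries are variables. *)
pose Zp : 'M[S]_(n, j) := \matrix_(i, a)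
  if insub i is Some i' then xi (inl (inl (i', a))) else (f a == i)%:R.
pose Wp : 'M[S]_(j, n) := \matrix_(a, c)
  if insub (a, c) is Some p then xi (inl (inr p)) else 1.
pose Xp := mxpoint (Zp *m Wp).
(* The entry at [q0] comes from solving the annihilation equation, in which its coefficient is 1. *)
pose Ap : 'M[S]_(m, n * n) := \matrix_(i, q)
  if insub q is Some q' then xi (inr (i, q'))
  else - \sum_(q' : Q) xi (inr (i, q')) * Xp (val q').
have [F FN0 F0] := alg_dep (fun c => mxvec Ap ord0 c) cardT.
exists F => // A Z W fZ W1 AX.
pose u0 (t : T) := match t with
  | inl (inl (i, a)) => Z (val i) a
  | inl (inr p) => W (val p).1 (val p).2
  | inr (i, q) => mxpoint (A i) (val q) end.
pose u (c : 'I_#|{: T}|) := u0 (enum_val c).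
rewrite -(F0 u); apply: meval_eq.
have xiu t : (xi t).@[u] = u0 t by rewrite mevalXU /u enum_rankK.
have Zu i a : (Zp i a).@[u] = Z i a.
  rewrite mxE; case: insubP => [i' _ <-|]; first by rewrite xiu.
  rewrite negbK => /codomP[a' ->].
  have := congr1 (fun M : 'M_j => M a' a) fZ; rewrite !mxE => ->.
  by rewrite (inj_eq f_inj) eq_sym rmorph_nat.
have Wu a c : (Wp a c).@[u] = W a c.
  rewrite mxE; case: insubP => [p _ Ep|]; first by rewrite xiu /= Ep.
  by rewrite negbK => /eqP[-> ->]; rewrite meval1.
have Xu q : (Xp q).@[u] = mxpoint (Z *m W) q.
  case/mxvec_indexP: q => i c; rewrite /Xp /mxpoint !mxvecE !mxE raddf_sum.
  by apply: eq_bigr => a _; rewrite /= mevalM Zu Wu.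
have X1 : mxpoint (Z *m W) q0 = 1.
  rewrite /mxpoint mxvecE mxE (bigD1 a0) //= big1 => [|a /negPf a_neq].
    have := congr1 (fun M : 'M_j => M a0 a0) fZ; rewrite !mxE eqxx => ->.
    by rewrite W1 mul1r addr0.
  have := congr1 (fun M : 'M_j => M a0 a) fZ; rewrite !mxE eq_sym a_neq => ->.
  by rewrite mul0r.
move=> c; case/mxvec_indexP: c => i q; rewrite !mxvecE [LHS]mxE [Ap _ _]mxE.
case: insubP => [q' _ <-|]; first by rewrite xiu.
rewrite negbK => /eqP ->.
have := AX i; rewrite /lform (bigD1 q0) //= X1 mulr1 => /eqP.
rewrite addr_eq0 => /eqP AE; rewrite -[LHS]/(mxpoint (A i) q0) AE.
rewrite mevalN; congr (- _); rewrite [RHS]raddf_sum /=.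
rewrite (reindex_omap (val : Q -> _) insub) => [|q1 q1_neq]; last by rewrite insubT.
apply: eq_big => [q'|q' _]; first by rewrite valK eqxx andbT (valP q').
by rewrite mevalM xiu Xu.
Qed.

Lemma lform_scaler (K : comNzRingType) N (b v : 'I_N -> K) a :
  lform b (fun c => a * v c) = a * lform b v.
Proof. by rewrite /lform mulr_sumr; apply: eq_bigr => c _; rewrite mulrCA. Qed.

(** Let [R] consist of a maximal set of independent rows of [X], so that X = Z R. Restricting to
    these rows gives R = (rowsub f Z) R, and freeness of [R] makes that block of [Z] the identity.
    Dividing [R] by a nonzero entry normalizes it. *)
Lemma rank_chart (K : fieldType) n (X : 'M[K]_n) : X != 0 ->
  exists a0 b0 (x : K) (Z : 'M_(n, \rank X)) (W : 'M_(\rank X, n)),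
    [/\ rowsub (maxrankfun X) Z = 1%:M, W a0 b0 = 1 & Z *m W = x *: X].
Proof.
move=> X0; pose f := maxrankfun X; set R := rowsub f X.
have Rfree : row_free R := maxrowsub_free X.
have /submxP[Z XE] : (X <= R)%MS by rewrite eq_maxrowsub.
have R0 : R != 0 by apply: contraNneq X0 => R0; rewrite XE R0 mulmx0.
have /matrix0Pn[a0 [b0 Rab]] := R0.
exists a0, b0, (R a0 b0)^-1, Z, ((R a0 b0)^-1 *: R); split.
- by apply: (row_free_inj Rfree); rewrite mul1mx mul_rowsub_mx -XE.
- by rewrite mxE mulVf.
- by rewrite -scalemxAr -XE.
Qed.

(** Up to scaling, finitely many charts cover the nonzero matrices of rank at most [k]: one for each
    rank, choice of rows and normalized position. [F] is the product of the chart polynomials. *)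
Lemma generic_kernel (K : numFieldType) n k m :
  (k <= n)%N -> (n * n - (n - k) * (n - k) <= m)%N ->
  exists2 F : {mpoly K[m * (n * n)]}, F != 0 &
    forall A : 'I_m -> 'M[K]_n, F.@[tuple_point A ord0] != 0 ->
    forall X, (\rank X <= k)%N ->
      (forall i, lform (mxpoint (A i)) (mxpoint X) = 0) -> X = 0.
Proof.
move=> le_kn le_m.
pose I := {j : 'I_k.+1 & ({ffun 'I_j -> 'I_n} * ('I_j * 'I_n))%type}.
have /choice[F FP] (x : I) : exists F : {mpoly K[m * (n * n)]}, F != 0 /\
    forall (A : 'I_m -> 'M[K]_n) Z (W : 'M_(_, n)),
      injective (tagged x).1 ->
      rowsub (tagged x).1 Z = 1%:M -> W (tagged x).2.1 (tagged x).2.2 = 1 ->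
      (forall i, lform (mxpoint (A i)) (mxpoint (Z *m W)) = 0) ->
      F.@[tuple_point A ord0] = 0.
  case: x => -[j lt_jk] [f [a0 b0]] /=; rewrite /= in f a0 *.
  (* A non-injective [f] gives no chart and contributes the factor 1. *)
  have [/injectiveP f_inj|fNinj] := boolP (injectiveb f); last first.
    by exists 1; split=> [|A Z W /injectiveP]; rewrite ?oner_neq0 ?(negPf fNinj).
  have [|G G0 GP] := chart_alg_dep K (m := m) a0 b0 f_inj.
    (* (n-j) j + j n = n^2 - (n-j)^2 grows with [j] up to [n], so the bound for [k] covers every
       rank up to [k]. *)
    apply: leq_trans le_m; have [d En] : exists d, n = (k + d)%N by exists (n - k)%N; lia.
    have [e Ek] : exists e, k = (j + e)%N by exists (k - j)%N; lia.
    rewrite En Ek; nia.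
  by exists G; split=> // A Z W _; apply: GP.
exists (\prod_x F x).
  by apply/prodf_neq0 => x _; have [] := FP x.
move=> A FA X Xk AX; apply/eqP/contraT => X0.
have [a0 [b0 [x [Z [W [fZ W1 ZW]]]]]] := rank_chart X0.
have lt_k : (\rank X < k.+1)%N by [].
pose t : I := Tagged (fun j : 'I_k.+1 => ({ffun 'I_j -> 'I_n} * ('I_j * 'I_n))%type)
  (i := Ordinal lt_k) (maxrankfun X, (a0, b0)).
have [_ Ft] := FP t.
case/eqP: FA; rewrite rmorph_prod (bigD1 t) //= (Ft A Z W) ?mul0r //.
  exact: maxrankfun_inj.
move=> i; rewrite ZW (_ : mxpoint (x *: X) = fun c => x * mxpoint X c).
  by rewrite lform_scaler AX mulr0.
by apply/funext => c; rewrite /mxpoint linearZ mxE.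
Qed.

(** * Measurements as linear forms, and differences of matrices of low rank *)

Lemma lform_mxE (K : comNzRingType) n (A B : 'M[K]_n) :
  lform (mxpoint A) (mxpoint B) = \sum_i \sum_j A i j * B i j.
Proof.
rewrite /lform pair_bigA (reindex _ (curry_mxvec_bij n n)) /=.
by apply: eq_bigr => -[i j] _; rewrite /mxpoint /= !mxvecE.
Qed.

Lemma inner_mxE (R : realType) n (A Q : 'M[complex R]_n) :
  inner_mx A Q = lform (mxpoint (map_mx Num.conj A)) (mxpoint Q).
Proof.
rewrite lform_mxE exchange_big; apply: eq_bigr => j _.
by rewrite !mxE; apply: eq_bigr => i _; rewrite !mxE.
Qed.

(** Genericity needs a polynomial in the entries of [A] themselves, so the conjugation is moved to
    [Q], where it does not change the rank. *)
Lemma inner_mx_conj (R : realType) n (A Q : 'M[complex R]_n) :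
  inner_mx A Q = Num.conj (lform (mxpoint A) (mxpoint (map_mx Num.conj Q))).
Proof.
rewrite inner_mxE !lform_mxE rmorph_sum; apply: eq_bigr => i _.
by rewrite rmorph_sum; apply: eq_bigr => j _; rewrite rmorphM !mxE /= conjCK.
Qed.

Lemma inner_mxB (R : realType) n (A X Y : 'M[complex R]_n) :
  inner_mx A (X - Y) = inner_mx A X - inner_mx A Y.
Proof. by rewrite /inner_mx mulmxBr raddfB. Qed.

(** [X] factors through dimension [r + r]; cutting the inner index range in two halves splits the
    product into two terms of rank at most [r]. *)
Lemma mxrank_split (K : fieldType) n r (X : 'M[K]_n) : (\rank X <= r + r)%N ->
  exists X1 X2, [/\ X = X1 - X2, (\rank X1 <= r)%N & (\rank X2 <= r)%N].
Proof.
move=> Xr; pose U : 'M_(n, r + r) := col_ebase X *m pid_mx (\rank X).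
pose W : 'M_(r + r, n) := pid_mx (\rank X) *m row_ebase X.
have XE : X = U *m W.
  rewrite /U /W mulmxA -[col_ebase X *m _ *m _]mulmxA mul_pid_mx minnn.
  by rewrite (minn_idPr Xr) mulmx_ebase.
exists (lsubmx U *m usubmx W), (- rsubmx U *m dsubmx W); split.
- by rewrite mulNmx opprK -mul_row_col hsubmxK vsubmxK.
- exact: mulmx_max_rank.
- exact: mulmx_max_rank.
Qed.

(* The subtraction in nat below is exact, since r <= n. *)
Theorem theorem2p1 (R : realType) (n r m : nat)
    (n_gt0 : (0 < n)%N) (r_gt0 : (0 < r)%N) (m_gt0 : (0 < m)%N)
    (r_le : (2 * r <= n)%N) :
  ((4 * n * r - 4 * r ^ 2 <= m)%N ->
    for_generic_matrices (fun A : 'I_m -> 'M[complex R]_n =>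
      {in rank_le R n r &, injective (meas_map A)}))
  /\
  ((m < 4 * n * r - 4 * r ^ 2)%N ->
    forall A : 'I_m -> 'M[complex R]_n,
      ~ {in rank_le R n r &, injective (meas_map A)}).
Proof.
have -> : (4 * n * r - 4 * r ^ 2 = n * n - (n - 2 * r) * (n - 2 * r))%N.
  by have [d ->] : exists d, n = (2 * r + d)%N; [exists (n - 2 * r)%N; lia | nia].
split=> [le_m | lt_m A A_inj].
  have [F FN0 FP] := generic_kernel (complex R) r_le le_m.
  exists [set v | F.@[v ord0] <> 0]%classic; split.
  - exists [set F]%classic; apply/seteqP; split=> v /=.
      by move=> /contrapT Fv p ->.
    by move=> Fv; apply; apply: Fv.
  - have [u Fu] := mpoly_meval_neq0 FN0; exists (\row_c u c) => /=; apply/eqP.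
    by rewrite (meval_eq _ (v2 := u)) // => c; rewrite mxE.
  - move=> A /eqP FA X Y; rewrite !inE => Xr Yr XY.
    apply/eqP; rewrite -subr_eq0 -(map_mx_eq0 Num.conj); apply/eqP.
    apply: (FP A FA) => [|i].
      rewrite mxrank_map (leq_trans (mxrank_add _ _)) // mxrank_opp mul2n -addnn.
      exact: leq_add.
    apply: (can_inj conjCK); rewrite -inner_mx_conj conjC0 inner_mxB.
    by have /rowP/(_ i) := XY; rewrite !mxE => ->; rewrite subrr.
have [X [X0 Xr XA]] := rank_le_meets_kernel (fun i => map_mx Num.conj (A i))
  (@complex_uncountable R) r_le lt_m.
rewrite mul2n -addnn in Xr.
(* The measurements vanish on X = X1 - X2, so they agree on [X1] and [X2]; injectivity would force X
   = 0. *)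
have [X1 [X2 [XE X1r X2r]]] := mxrank_split Xr.
case/eqP: X0; rewrite XE; apply/eqP; rewrite subr_eq0; apply/eqP.
apply: A_inj => //; apply/rowP => i; rewrite !mxE.
by apply/eqP; rewrite -subr_eq0 -inner_mxB -XE inner_mxE XA.
Qed.
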